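(* Let $(g_n,h_n)_{n=0}^\infty$ be a framing for $\mathcal F$ in the complex Hilbert space $\mathcal H$, where $\mathcal F\neq\{0\}$ is a linear subspace of $\mathcal H$. Let $A$ and $B$ be closed operators, densely defined in $\mathcal H$, such that $g_n\in\mathcal D(A)$ and $h_n\in\mathcal D(B)$ for all $n\geq 0$. Let $\mathcal D_B\subset\mathcal D(B^* )$ be a linear subspace which is dense in $\mathcal H$. Suppose that $$\mathcal F\subset\mathcal F_A:=\{g\in\mathcal H:\ g\in\mathcal D(A^* )\ \text{and}\ A^*g\in\mathcal F_{max}\}$$ and $$\langle A^*f,B^*h\rangle=\langle f,h\rangle\quad\text{for all } f\in\mathcal F,\ h\in\mathcal D_B .$$ If either of the following two conditions is satisfied: (i) for every $f\in\mathcal F$ the series $\sum_{n=0}^\infty\langle f,Ag_n\rangle Bh_n$ is either weakly subseries convergent or strongly subseries convergent; (ii) $B$ is a bounded operator; then $(Ag_n,Bh_n)_{n=0}^\infty$ is a framing for $\mathcal F$.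
   Context: $\mathcal H$ is a complex Hilbert space with inner product $\langle\cdot,\cdot\rangle$ linear in the first variable. Operators are linear and possibly unbounded; $\mathcal D(T)$ is the domain of $T$ and $T^*$ its adjoint. A pair of sequences $(g_n)_{n=0}^\infty$, $(h_n)_{n=0}^\infty$ in $\mathcal H$, written $(g_n,h_n)_{n=0}^\infty$, is a framing in $\mathcal H$ if $f=\sum_{n=0}^\infty\langle f,g_n\rangle h_n$ with unconditional norm convergence holds for at least one nonzero $f\in\mathcal H$. $\mathcal F_{max}$ denotes the linear subspace of all $f\in\mathcal H$ for which this expansion holds unconditionally (with respect to the given framing $(g_n,h_n)_{n=0}^\infty$). A framing is a framing for a linear subspace $\mathcal F$ if $\mathcal F$ is contained in its space of all vectors for which the corresponding expansion holds unconditionally; thus $(Ag_n,Bh_n)_{n=0}^\infty$ being a framing for $\mathcal F$ means $f=\sum_{n=0}^\infty\langle f,Ag_n\rangle Bh_n$ unconditionally in norm for every $f\in\mathcal F$. A series is weakly (strongly) subseries convergent if each of its subseries converges weakly (in norm) to some element of $\mathcal H$. *)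

(* Defs.v *)
From HB Require Import structures.
From mathcomp Require Import all_boot all_order all_algebra complex.
From mathcomp Require Import all_classical all_reals all_analysis.

Set Implicit Arguments.
Unset Strict Implicit.
Unset Printing Implicit Defensive.

Import Order.TTheory GRing.Theory Num.Theory.
Import numFieldNormedType.Exports.

Local Open Scope classical_set_scope.
Local Open Scope ring_scope.
Local Open Scope complex_scope.

(* A complex Hilbert space is a complete normed module [H] over [R[i]], with a
   positive definite hermitian form [ip : {dot H for Num.conj}], linear in its
   first variable, that induces the norm: *)
Definition induces_norm (R : realType) (H : completeNormedModType R[i])
    (ip : {dot H for Num.conj}) : Prop :=
  forall x : H, `|x| ^+ 2 = ip x x.

Definition linear_subspace (R : realType) (H : completeNormedModType R[i])
    (F : set H) : Prop :=
  submod_closed (mem F).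

(* A partially defined linear operator; the values of [op_fun] outside
   [op_dom] carry no information. *)
Record operator (R : realType) (H : completeNormedModType R[i]) := Operator {
  op_dom : set H ;
  op_fun :> H -> H ;
  op_dom_subspace : linear_subspace op_dom ;
  op_linear : forall (a : R[i]) (u v : H), op_dom u -> op_dom v ->
    op_fun (a *: u + v) = a *: op_fun u + op_fun v
}.

Section Operators.
Variables (R : realType) (H : completeNormedModType R[i]).
Variable ip : {dot H for Num.conj}.

Definition op_graph (T : operator H) : set (H * H) :=
  [set p | op_dom T p.1 /\ p.2 = T p.1].

Definition closed_operator (T : operator H) : Prop := closed (op_graph T).

Definition densely_defined (T : operator H) : Prop := dense (op_dom T).

(* For a closed densely defined operator this forces [op_dom T = setT]. *)
Definition bounded_operator (T : operator H) : Prop :=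
  exists M : R, forall x : H, op_dom T x -> `|T x| <= M%:C * `|x|.

Definition is_adjoint_value (T : operator H) (y z : H) : Prop :=
  forall x : H, op_dom T x -> ip (T x) y = ip x z.

Definition adjoint_dom (T : operator H) : set H :=
  [set y | exists z, is_adjoint_value T y z].

(* The adjoint value is unique when [T] is densely defined; outside
   [adjoint_dom T] this function is 0 by convention. *)
Definition adjoint (T : operator H) (y : H) : H :=
  xget 0 [set z | is_adjoint_value T y z].

End Operators.

Section Series.
Variables (R : realType) (H : completeNormedModType R[i]).
Variable ip : {dot H for Num.conj}.

Definition unconditional_sum (a : nat -> H) (s : H) : Prop :=
  forall sigma : nat -> nat, bijective sigma ->
    series (a \o sigma) @ \oo --> s.

(* [R[i]^o] carries the norm topology of the field [R[i]]. *)
Definition weakly_cvg_to (u : nat -> H) (l : H) : Prop :=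
  forall y : H, (fun n => ip (u n) y : R[i]^o) @ \oo --> (ip l y : R[i]^o).

Definition weakly_subseries_convergent (a : nat -> H) : Prop :=
  forall k : nat -> nat, {homo k : m n / (m < n)%N} ->
    exists s : H, weakly_cvg_to (series (a \o k)) s.

Definition strongly_subseries_convergent (a : nat -> H) : Prop :=
  forall k : nat -> nat, {homo k : m n / (m < n)%N} ->
    exists s : H, series (a \o k) @ \oo --> s.

End Series.

Section Framings.
Variables (R : realType) (H : completeNormedModType R[i]).
Variable ip : {dot H for Num.conj}.

Definition F_max (g h : nat -> H) : set H :=
  [set f | unconditional_sum (fun n => ip f (g n) *: h n) f].

Definition framing (g h : nat -> H) : Prop :=
  exists f : H, f <> 0 /\ F_max g h f.

Definition framing_for (g h : nat -> H) (F : set H) : Prop :=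
  framing g h /\ F `<=` F_max g h.

Definition F_op (A : operator H) (g h : nat -> H) : set H :=
  [set f | adjoint_dom ip A f /\ F_max g h (adjoint ip A f)].

End Framings.

(* Main.v *)
(* Put u = A^* f. Then <f, A g_n> = <u, g_n>, so the n-th term of the new series
   is B x_n, where x_n = <u, g_n> h_n is the n-th term of the expansion of u.
   Every rearrangement of the new series converges in norm: if B is bounded
   because the expansion of u does, and under (i) by the Orlicz-Pettis theorem
   (weak subseries convergence implies unconditional norm convergence).
   Finally, for k in the dense set D_B,
   <sum B x_n, k> = <sum x_n, B^* k> = <u, B^* k> = <f, k>, so the sum is f.
   It is enough to work with the real inner product Re <.,.>. *)
Require Import Defs.
From HB Require Import structures.
From mathcomp Require Import all_boot all_order all_algebra complex.
From mathcomp Require Import all_classical all_reals all_analysis.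
From mathcomp Require Import ring lra.

Import Order.TTheory GRing.Theory Num.Theory.
Import numFieldNormedType.Exports.

Local Open Scope classical_set_scope.
Local Open Scope ring_scope.
Local Open Scope complex_scope.

(** * Subset sums and rearrangements of series *)

(** Turns sums over an infinite index set into partial sums of a subseries: [k] lists the set
    increasingly and [c M] counts its elements below [M]. *)
Lemma infinite_subset_enum (P : pred nat) :
  (forall N, exists n, (N <= n)%N && P n) ->
  exists k c : nat -> nat, [/\ {homo k : m n / (m < n)%N}, c @ \oo --> \oo &
    forall (V : zmodType) (a : nat -> V) M,
      \sum_(0 <= n < M | P n) a n = series (a \o k) (c M)].
Proof.
move=> infP; pose next N := ex_minn (infP N).
have next_ge N : (N <= next N)%N by rewrite /next; case: ex_minnP => m /andP[].
have nextP N : P (next N) by rewrite /next; case: ex_minnP => m /andP[].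
have next_id N : P N -> next N = N.
  move=> PN; apply/eqP; rewrite eqn_leq next_ge andbT.
  by rewrite /next; case: ex_minnP => m _; apply; rewrite leqnn.
have nextS N : ~~ P N -> next N.+1 = next N.
  move=> nPN; apply/eqP; rewrite eqn_leq; apply/andP; split.
    have next_min : (forall n, (N < n)%N && P n -> next N.+1 <= n)%N.
      by rewrite /next; case: ex_minnP.
    apply: next_min; rewrite nextP andbT ltn_neqAle next_ge andbT.
    by apply: contra nPN => /eqP ->.
  have next_min : (forall n, (N <= n)%N && P n -> next N <= n)%N.
    by rewrite /next; case: ex_minnP.
  apply: next_min; rewrite nextP andbT.
  exact: leq_trans (leqnSn N) (next_ge _).
pose fix k i := if i is j.+1 then next (k j).+1 else next 0%N.
pose c M := count P (iota 0 M).
have cS M : c M.+1 = (c M + P M)%N by rewrite /c -addn1 iotaD count_cat /= addn0.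
(* The least element of [P] not below [M] is preceded by exactly [c M] elements of [P]. *)
have next_k M : next M = k (c M).
  elim: M => // M IH; rewrite cS; case: (boolP (P M)) => PM.
    by rewrite addn1 /= -IH (next_id M).
  by rewrite addn0 -IH nextS.
exists k, c; split.
- by apply: homo_ltn => [? ? ?|i]; [exact: ltn_trans | exact: next_ge].
- have c_mono m n : (m <= n)%N -> (c m <= c n)%N.
    move=> /subnK <-; elim: (n - m)%N => // i IH.
    by rewrite addSn cS (leq_trans IH) // leq_addr.
  have c_ge i : exists M, (i <= c M)%N.
    elim: i => [|i [M iM]]; first by exists 0%N.
    exists (next M).+1; rewrite cS nextP addn1 ltnS.
    exact: leq_trans iM (c_mono _ _ (next_ge M)).
  move=> A [K _ KA]; have [M KM] := c_ge K; exists M => // n /= Mn.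
  by apply: KA => /=; exact: leq_trans KM (c_mono _ _ Mn).
- move=> V a; elim=> [|M IH]; first by rewrite /series /= !big_geq.
  rewrite big_mkcond big_nat_recr //= -big_mkcond /= IH cS.
  case: (boolP (P M)) => PM; last by rewrite addn0 addr0.
  by rewrite addn1 seriesSr /= -next_k next_id.
Qed.

(** Cauchy criterion: a block of the rearranged series that starts late enough is a sum of [a] over
    a finite set of indices, all at least [N]. *)
Lemma permuted_series_cvg (K : numFieldType) (V : completeNormedModType K)
    (a : nat -> V) :
  (forall e : K, 0 < e -> exists N : nat, forall (M : nat) (P : pred nat),
     `|\sum_(N <= n < M | P n) a n| < e) ->
  forall sigma, bijective sigma -> cvgn (series (a \o sigma)).
Proof.
move=> tail sigma [tau sigmaK tauK].
apply/cauchy_cvgP/cauchy_seriesP => e /tail[N N_tail].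
(* Every index below [N] occurs at a position below [n0] in the rearrangement. *)
pose n0 := (\max_(i < N) tau i).+1.
have n0_sigma i : (n0 <= i)%N -> (N <= sigma i)%N.
  rewrite leqNgt => ni; rewrite leqNgt; apply: contra ni => iN.
  by rewrite ltnS -{1}(sigmaK i) (leq_bigmax (Ordinal iN)).
exists ([set n | (n0 <= n)%N], [set n | (n0 <= n)%N]).
  by split; exact: nbhs_infty_ge.
move=> [m n] [/= n0m _].
pose M := (\max_(i < n) sigma i).+1.
suff -> : \sum_(m <= k < n) a (sigma k) =
    \sum_(N <= j < M | (m <= tau j < n)%N) a j by exact: N_tail.
rewrite -(big_map sigma xpredT a) -[RHS]big_filter; apply: perm_big.
apply: uniq_perm.
- by rewrite map_inj_uniq ?iota_uniq //; exact: can_inj sigmaK.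
- by rewrite filter_uniq // iota_uniq.
move=> j; rewrite mem_filter mem_index_iota -{1}(tauK j) mem_map; last first.
  exact: can_inj sigmaK.
rewrite mem_index_iota; case: (boolP (m <= tau j < n)%N) => //= /andP[mj jn].
rewrite -(tauK j) n0_sigma ?(leq_trans n0m) //= ltnS tauK -{1}(tauK j).
by rewrite (leq_bigmax (Ordinal jn)).
Qed.

(** Taking for [P] the indices with [0 <= b n], then the others, gives absolute convergence; a tail
    of the absolute values dominates all subset sums at once. *)
Lemma subset_summable_tail (R : realType) (b : nat -> R) :
  (forall P : pred nat, cvgn (fun N => \sum_(0 <= n < N | P n) b n)) ->
  forall d : R, 0 < d -> exists N : nat, forall (M : nat) (P : pred nat),
    `|\sum_(N <= n < M | P n) b n| <= d.
Proof.
move=> b_cvg d d0.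
have abs_cvg : cvgn (series (fun n => `|b n|)).
  have -> : series (fun n => `|b n|) =
      (fun N => \sum_(0 <= n < N | 0 <= b n) b n) -
      (fun N => \sum_(0 <= n < N | ~~ (0 <= b n)) b n).
    apply/funext => N; rewrite /series /= !fctE (bigID (fun n => 0 <= b n)) /=.
    rewrite -sumrN; congr (_ + _); apply: eq_bigr => n bn.
      by rewrite ger0_norm.
    by rewrite ltr0_norm // ltNge.
  by apply: is_cvgB; exact: b_cvg.
have /cauchy_cvgP/cauchy_seriesP/(_ d d0) := abs_cvg.
case=> -[U V] /= [[N1 _ N1U] [N2 _ N2V]] UV.
exists (maxn N1 N2) => M P; case: (leqP M (maxn N1 N2)) => [?|NM].
  by rewrite big_geq // normr0 ltW.
apply: (le_trans (ler_norm_sum _ _ _)).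
have := UV (maxn N1 N2, M) (conj (N1U _ (leq_maxl _ _))
  (N2V _ (leq_trans (leq_maxr _ _) (ltnW NM)))) => /=.
rewrite ger0_norm ?sumr_ge0 // => /ltW; apply: le_trans.
by rewrite [leRHS](bigID P) /= lerDl sumr_ge0.
Qed.

(** * The Orlicz-Pettis theorem for a symmetric biadditive real form *)

Section GlidingHump.
Variables (R : realType) (V : zmodType) (q : V -> V -> R).
Hypothesis qDl : forall x y z, q (x + y) z = q x z + q y z.
Hypothesis qC : forall x y, q x y = q y x.
Variable a : nat -> V.
Hypothesis subseries_sums : forall k : nat -> nat,
  {homo k : m n / (m < n)%N} ->
  exists s, forall y, (fun n => q (series (a \o k) n) y) @ \oo --> q s y.

Let q0l y : q 0 y = 0.
Proof. by have := qDl 0 0 y; rewrite addr0 -[LHS]addr0 => /addrI. Qed.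

Let q_suml I (r : seq I) P (F : I -> V) y :
  q (\sum_(i <- r | P i) F i) y = \sum_(i <- r | P i) q (F i) y.
Proof. by apply: (big_morph (q^~ y)) => // u v; exact: qDl. Qed.

(** An infinite [P] gives a subseries; for a finite [P] the sums are eventually constant. The same
    [s] serves all [y]. *)
Let subset_sums (P : pred nat) : exists s, forall y,
  (fun N => \sum_(0 <= n < N | P n) q (a n) y) @ \oo --> q s y.
Proof.
have [/infinite_subset_enum[k [c [k_incr c_cvg sum_k]]]|] :=
    pselect (forall N, exists n, (N <= n)%N && P n).
  have [s s_lim] := subseries_sums k k_incr; exists s => y.
  have -> : (fun N => \sum_(0 <= n < N | P n) q (a n) y) =
      (fun n => q (series (a \o k) n) y) \o c.
    by apply/funext => N /=; rewrite -q_suml sum_k.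
  exact: cvg_comp c_cvg (s_lim y).
move=> /existsNP[N /forallNP finP].
exists (\sum_(0 <= n < N | P n) a n) => y; rewrite q_suml.
apply: cvg_near_cst; exists N => // M /= NM; apply/eqP.
rewrite (@big_cat_nat _ _ _ N) //= [X in _ + X]big_nat_cond.
rewrite [X in _ + X]big_pred0 ?addr0 // => n.
apply/negbTE/negP => /andP[/andP[Nn _] Pn].
by apply: (finP n); rewrite Nn.
Qed.

(** One extension of the subset under construction: earlier choices are kept, a hump of size [eps]
    is added on [[N, N')], and whatever is chosen from [N'] on interacts with the sum so far by at
    most [d]. *)
Let hump_step (eps d : R) (P : pred nat) (N : nat) (P' : pred nat) N' :=
  [/\ forall n, (n < N)%N -> P' n = P n, (N < N')%N,
      eps <= q (\sum_(N <= n < N' | P' n) a n) (\sum_(N <= n < N' | P' n) a n)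
    & forall M (Q : pred nat), `|\sum_(N' <= n < M | Q n)
        q (a n) (\sum_(0 <= m < N' | P' m) a m)| <= d].

Let tail_small d y : 0 < d -> exists N, forall M (Q : pred nat),
  `|\sum_(N <= n < M | Q n) q (a n) y| <= d.
Proof.
move=> d0; apply: subset_summable_tail d0 => P.
by have [s /(_ y) sy] := subset_sums P; apply/cvg_ex; exists (q s y).
Qed.

(** [P'] is [P] below [N], the bad set [Q] on [[N, M)] and empty from [K] on. Hence [N'] can be
    pushed past the threshold [T] of the sum so far without changing that sum. *)
Let hump_stepE (eps d : R) : 0 < d ->
  (forall N, exists M (P : pred nat), eps <=
     q (\sum_(N <= n < M | P n) a n) (\sum_(N <= n < M | P n) a n)) ->
  forall P N, exists P' N', hump_step eps d P N P' N'.
Proof.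
move=> d0 bad P N; have [M [Q epsQ]] := bad N.
pose P' n := if (n < N)%N then P n else (n < M)%N && Q n.
pose K := maxn N.+1 M.
have [T tailT] := tail_small d (\sum_(0 <= m < K | P' m) a m) d0.
have P'K n : P' n -> (n < K)%N.
  rewrite /P' /K leq_max; case: (ltnP n N) => [nN _|_ /andP[->]].
    by rewrite ltnS ltnW.
  by rewrite orbT.
exists P', (maxn K T); split.
- by move=> n nN; rewrite /P' nN.
- by rewrite !leq_max leqnn.
- suff -> : \sum_(N <= n < maxn K T | P' n) a n = \sum_(N <= n < M | Q n) a n.
    by [].
  have MK : (M <= maxn K T)%N by rewrite !leq_max leqnn orbT.
  rewrite [RHS](big_nat_widen _ _ _ _ _ MK) [LHS]big_nat_cond [RHS]big_nat_cond.
  apply: eq_bigl => n; rewrite /P'; case: (ltnP n N) => //= nN.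
  by case: (ltnP n M) => nM; rewrite ?andbF //= ?andbT (leq_trans nM MK).
- move=> M' Q'.
  suff -> : \sum_(0 <= m < maxn K T | P' m) a m = \sum_(0 <= m < K | P' m) a m.
    rewrite (big_nat_widenl _ T); last exact: leq_maxr.
    exact: tailT.
  rewrite [RHS](big_nat_widen _ _ (maxn K T)) ?leq_maxl //.
  by apply: eq_bigl => n; case: (boolP (P' n)) => // /P'K ->.
Qed.

(* Orlicz-Pettis by a gliding hump: otherwise there are sums [S l] over initial
   segments of one subset, of weak limit [s], with [q (S l) (S l)] increasing by
   almost [eps] at each step, while [q (S l) (S l)] stays close to [q s (S l)],
   which converges. *)
Lemma subset_sums_tail (eps : R) : 0 < eps ->
  exists N, forall M (P : pred nat),
    q (\sum_(N <= n < M | P n) a n) (\sum_(N <= n < M | P n) a n) < eps.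
Proof.
move=> eps0; apply: contrapT => /forallNP noN.
(* At the end two values lie less than [2 * d] from [q s s], yet differ by at least
   [eps - 2 * d = 4 * d]. *)
pose d := eps / 6; have d0 : 0 < d by rewrite /d; lra.
have bad N : exists M (P : pred nat), eps <=
    q (\sum_(N <= n < M | P n) a n) (\sum_(N <= n < M | P n) a n).
  have /existsNP[M /existsNP[P /negP]] := noN N.
  by rewrite -leNgt => ?; exists M, P.
have /choice[f f_step] (x : pred nat * nat) :
    exists y : pred nat * nat, hump_step eps d x.1 x.2 y.1 y.2.
  case: x => P N; have [P' [N' H]] := hump_stepE eps d d0 bad P N.
  by exists (P', N').
pose st l := iter l f (xpred0, 0%N).
pose N l := (st l).2.
have N_lt l : (N l < N l.+1)%N by have [] := f_step (st l).
have N_mono l m : (l <= m)%N -> (N l <= N m)%N.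
  move=> /subnK <-; elim: (m - l)%N => // k IH.
  by rewrite addSn (leq_trans IH) // ltnW.
have N_ge l : (l <= N l)%N.
  by elim: l => // l IH; rewrite (leq_ltn_trans IH).
have st_eq l m n : (l <= m)%N -> (n < N l)%N -> (st m).1 n = (st l).1 n.
  move=> /subnK <-; elim: (m - l)%N => // k IH nNl.
  rewrite addSn -IH //; have [-> //] := f_step (st (k + l)%N).
  by rewrite (leq_trans nNl) // N_mono // leq_addl.
(* Diagonal choice: membership of [n] is settled by stage [n.+1], since [n < N n.+1]. *)
pose P n := (st n.+1).1 n.
have P_eq l n : (n < N l)%N -> P n = (st l).1 n.
  move=> nl; rewrite /P -(st_eq n.+1 (maxn l n.+1)) ?leq_maxr //.
  by rewrite (st_eq l) ?leq_maxl.
pose S l := \sum_(0 <= n < N l | P n) a n.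
have [s s_lim] := subset_sums P.
have P_sum m l : \sum_(m <= n < N l | P n) a n = \sum_(m <= n < N l | (st l).1 n) a n.
  rewrite big_nat_cond [RHS]big_nat_cond; apply: eq_bigl => n.
  by case: (boolP (m <= n < N l)%N) => //= /andP[_ /P_eq ->].
have S_tail l M (Q : pred nat) :
    `|\sum_(N l.+1 <= n < M | Q n) q (a n) (S l.+1)| <= d.
  by rewrite /S P_sum; have [_ _ _] := f_step (st l).
have S_hump l : eps <= q (\sum_(N l <= n < N l.+1 | P n) a n)
    (\sum_(N l <= n < N l.+1 | P n) a n).
  by rewrite P_sum; have [_ _] := f_step (st l).
have SS l : S l.+1 = S l + \sum_(N l <= n < N l.+1 | P n) a n.
  by rewrite /S (@big_cat_nat _ _ _ (N l)) //= ltnW.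
have N_cvg : N @ \oo --> \oo.
  move=> A [K _ KA]; exists K => // n /= Kn; apply: KA => /=.
  exact: leq_trans (N_ge n).
have S_lim : (fun l => q (S l) s) @ \oo --> q s s.
  have -> : (fun l => q (S l) s) =
      (fun M => \sum_(0 <= n < M | P n) q (a n) s) \o N.
    by apply/funext => l /=; rewrite /S q_suml.
  exact: cvg_comp N_cvg (s_lim s).
(* [q s (S l.+1)] is the limit of the pairings of longer sums with [S l.+1], and the terms added
   after [S l.+1] contribute at most [d]. *)
have close l : `|q s (S l.+1) - q (S l.+1) (S l.+1)| <= d.
  apply/ler_addgt0Pr => e e0.
  have /cvgrPdist_lt/(_ e e0)[K _ HK] := s_lim (S l.+1).
  pose M := maxn K (N l.+1).
  have := HK M (leq_maxl _ _).
  rewrite (@big_cat_nat _ _ _ (N l.+1)) ?leq_maxr //= -q_suml -/(S l.+1).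
  set t := \sum_(N l.+1 <= _ < M | _) _ => lt_e.
  have t_d : `|t| <= d by exact: S_tail.
  rewrite (_ : _ - _ = q s (S l.+1) - (q (S l.+1) (S l.+1) + t) + t); last lra.
  by rewrite (le_trans (ler_normD _ _)) // addrC lerD // ltW.
(* With [x] the new hump, expand [q (S + x) (S + x)]: [q x x] is at least [eps] and each of the two
   cross terms at least [- d]. *)
have grow l : q (S l.+1) (S l.+1) + eps - 2 * d <= q (S l.+2) (S l.+2).
  have := S_tail l (N l.+2) P; have := S_hump l.+1.
  rewrite -q_suml (SS l.+1); set x := \sum_(_ <= _ < _ | _) _ => xx.
  rewrite ler_norml => /andP[? ?].
  rewrite qDl (qC _ (_ + _)) [q x _]qC !qDl (qC (S l.+1) x); lra.
have /cvgrPdist_lt/(_ d d0)[K _ HK] := S_lim.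
have := HK K.+1 (leqnSn K); have := HK K.+2 (leqW (leqnSn K)) => /=.
rewrite !(qC (S _) s) !ltr_norml => /andP[? ?] /andP[? ?].
have := close K; have := close K.+1; rewrite !ler_norml => /andP[? ?] /andP[? ?].
have := grow K; have : eps = 6 * d by rewrite /d; lra.
lra.
Qed.

End GlidingHump.

(** * The real inner product, Cauchy-Schwarz, and unconditional convergence *)

Section RealInnerProduct.
Variables (R : realType) (H : completeNormedModType R[i]).
Variable ip : {dot H for Num.conj}.
Hypothesis ip_norm : induces_norm ip.

Definition rip (x y : H) : R := complex.Re (ip x y).

(** The norm takes values in [R[i]]; this is the same number in [R]. *)
Definition rnorm (x : H) : R := complex.Re `|x|.

Lemma ipC x y : ip x y = Num.conj (ip y x).
Proof. by rewrite hermC expr0 mul1r. Qed.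

Lemma ReD (x y : R[i]) : complex.Re (x + y) = complex.Re x + complex.Re y.
Proof. by case: x y => [? ?] [? ?]. Qed.

Lemma Re_conj (z : R[i]) : complex.Re (Num.conj z) = complex.Re z.
Proof. by case: z. Qed.

Lemma Re_realM (r : R) (z : R[i]) : complex.Re (r%:C * z) = r * complex.Re z.
Proof. by case: z => u v /=; rewrite mul0r subr0. Qed.

Lemma ripDl x y z : rip (x + y) z = rip x z + rip y z.
Proof. by rewrite /rip linearDl ReD. Qed.

Lemma ripC x y : rip x y = rip y x.
Proof. by rewrite /rip ipC Re_conj. Qed.

Lemma ripZl (r : R) x y : rip (r%:C *: x) y = r * rip x y.
Proof. by rewrite /rip linearZl_LR; exact: Re_realM. Qed.

Lemma ripNl x y : rip (- x) y = - rip x y.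
Proof. by rewrite -scaleN1r -(rmorphN1 (real_complex R)) ripZl mulN1r. Qed.

Lemma ripBl x y z : rip (x - y) z = rip x z - rip y z.
Proof. by rewrite ripDl ripNl. Qed.

Lemma ripBr x y z : rip x (y - z) = rip x y - rip x z.
Proof. by rewrite ripC ripBl !(ripC _ x). Qed.

Lemma ripZr (r : R) x y : rip x (r%:C *: y) = r * rip x y.
Proof. by rewrite ripC ripZl ripC. Qed.

Lemma rip0l y : rip 0 y = 0.
Proof. by rewrite /rip linear0l. Qed.

Lemma rip_suml (I : Type) (r : seq I) P (F : I -> H) y :
  rip (\sum_(i <- r | P i) F i) y = \sum_(i <- r | P i) rip (F i) y.
Proof.
apply: (big_morph (rip^~ y)) => [u v|]; [exact: ripDl | exact: rip0l].
Qed.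

Lemma norm_rnorm x : `|x| = (rnorm x)%:C.
Proof. by rewrite RRe_real. Qed.

Lemma rnorm_ge0 x : 0 <= rnorm x.
Proof. by have := normr_ge0 x; rewrite norm_rnorm lecR. Qed.

Lemma rip_rnorm x : rip x x = rnorm x ^+ 2.
Proof. by rewrite /rip -ip_norm norm_rnorm -rmorphXn. Qed.

Lemma rip_le_rnorm x y : `|rip x y| <= rnorm x * rnorm y.
Proof.
have quad t : 0 <= rnorm x ^+ 2 - 2 * t * rip x y + t ^+ 2 * rnorm y ^+ 2.
  have : 0 <= rip (x - t%:C *: y) (x - t%:C *: y) by rewrite rip_rnorm sqr_ge0.
  rewrite ripBl !ripBr !ripZl !ripZr (ripC y x) !rip_rnorm.
  lra.
have x0 := rnorm_ge0 x; have := rnorm_ge0 y.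
rewrite le_eqVlt => /orP[/eqP y0|y0].
  rewrite -y0 mulr0 normr_le0; apply: contrapT => /negP xy0.
  (* With [rnorm y = 0], this parameter makes the quadratic equal to -1. *)
  have := quad ((rnorm x ^+ 2 + 1) / rip x y / 2).
  rewrite -y0 expr0n /= mulr0 addr0 (_ : 2 * _ * _ = rnorm x ^+ 2 + 1).
    by lra.
  by field.
rewrite -(ler_pXn2r (n := 2)) ?nnegrE ?mulr_ge0 //; last exact: ltW.
rewrite real_normK ?num_real //.
(* The minimizer of the quadratic. *)
have := quad (rip x y / rnorm y ^+ 2).
have y2 : 0 < rnorm y ^+ 2 by rewrite exprn_gt0.
move/(mulr_ge0 (ltW y2)); rewrite -subr_ge0; congr (is_true (0 <= _)).
by field; rewrite gt_eqF.
Qed.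

Lemma cvg_rnorm (u : nat -> H) (s : H) : u @ \oo --> s ->
  forall e : R, 0 < e -> \forall n \near \oo, rnorm (s - u n) < e.
Proof.
move=> us e e0; have /cvgrPdist_lt/(_ e%:C) := us.
rewrite ltcR => /(_ e0); apply: filterS => n.
by rewrite norm_rnorm ltcR.
Qed.

Lemma cvg_rip (u : nat -> H) (s y : H) : u @ \oo --> s ->
  (fun n => rip (u n) y) @ \oo --> rip s y.
Proof.
move=> us; apply/cvgrPdist_lt => e e0.
have y0 : 0 < rnorm y + 1 by rewrite ltr_wpDl ?rnorm_ge0.
have := cvg_rnorm _ _ us _ (divr_gt0 e0 y0); apply: filterS => n lt_e.
rewrite -ripBl (le_lt_trans (rip_le_rnorm _ _)) //.
rewrite (@le_lt_trans _ _ (rnorm (s - u n) * (rnorm y + 1))) //.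
  by rewrite ler_wpM2l ?rnorm_ge0 // lerDl.
by rewrite -ltr_pdivlMr.
Qed.

Lemma weakly_cvg_rip (u : nat -> H) (s y : H) : weakly_cvg_to ip u s ->
  (fun n => rip (u n) y) @ \oo --> rip s y.
Proof.
move=> /(_ y) us; apply/cvgrPdist_lt => e e0.
have /cvgrPdist_lt/(_ e%:C) := us; rewrite ltcR => /(_ e0).
apply: filterS => n; rewrite -linearBl /= -ripBl -ltcR; apply: le_lt_trans.
exact: normc_ge_Re.
Qed.

(** If [z = x - y] were nonzero, some [k] in [D] would be closer to [z] than [|z|]; but [z] is
    orthogonal to [k], so the squared distance is [|z|^2 + |k|^2]. *)
Lemma dense_rip_inj (D : set H) (x y : H) : dense D ->
  (forall k, D k -> rip x k = rip y k) -> x = y.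
Proof.
move=> D_dense xyD; apply/eqP; rewrite -subr_eq0 -normr_le0 real_leNgt //.
apply/negP; set z := x - y => z0.
have [k [+ Dk]] : ball z `|z| `&` D !=set0.
  apply: D_dense; last exact: ball_open.
  by exists z; exact: ballxx.
rewrite -ball_normE /= !norm_rnorm ltcR ltNge => /negP; apply.
rewrite -(ler_pXn2r (n := 2)) ?nnegrE ?rnorm_ge0 // -!rip_rnorm.
have zk : rip z k = 0 by rewrite ripBl xyD // subrr.
rewrite (ripBl z k) !(ripBr _ z k) (ripC k z) zk (rip_rnorm k).
by have := sqr_ge0 (rnorm k); lra.
Qed.

(** Both modes of convergence imply convergence against [rip], and [rip x x] is the squared norm, so
    the gliding hump bounds all late subset sums in norm. *)
Lemma subseries_unconditional (a : nat -> H) :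
  weakly_subseries_convergent ip a \/ strongly_subseries_convergent a ->
  forall sigma, bijective sigma -> cvgn (series (a \o sigma)).
Proof.
move=> a_cvg; apply: permuted_series_cvg => e e0.
have eE : e = (complex.Re e)%:C by rewrite RRe_real // gtr0_real.
have e0' : 0 < complex.Re e by rewrite -ltcR -eE.
have a_sub (k : nat -> nat) : {homo k : m n / (m < n)%N} ->
    exists s, forall y, (fun n => rip (series (a \o k) n) y) @ \oo --> rip s y.
  move=> k_incr; case: a_cvg => /(_ k k_incr)[s s_lim]; exists s => y.
    exact: weakly_cvg_rip.
  exact: cvg_rip.
have [N tailN] := subset_sums_tail _ _ rip ripDl ripC a a_sub _
  (exprn_gt0 2 e0').
exists N => M P; rewrite eE norm_rnorm ltcR.
by rewrite -(ltr_pXn2r (n := 2)) ?nnegrE ?rnorm_ge0 ?(ltW e0') // -rip_rnorm.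
Qed.

(** * Partially defined operators and their adjoints *)

Lemma op_dom0 (T : operator H) : op_dom T 0.
Proof. by have [/set_mem] := op_dom_subspace T. Qed.

Lemma op_domP (T : operator H) c u v : op_dom T u -> op_dom T v ->
  op_dom T (c *: u + v).
Proof.
have [_ T_lin] := op_dom_subspace T => Tu Tv.
by apply/set_mem/T_lin; exact/mem_set.
Qed.

Lemma op_fun0 (T : operator H) : T 0 = 0.
Proof.
have := op_linear (1 : R[i]) (op_dom0 T) (op_dom0 T).
by rewrite !scale1r addr0 -[LHS]addr0 => /addrI.
Qed.

Lemma op_funZ (T : operator H) c u : op_dom T u -> T (c *: u) = c *: T u.
Proof.
move=> Tu; have := op_linear c Tu (op_dom0 T).
by rewrite op_fun0 !addr0.
Qed.

Lemma op_sum (T : operator H) (I : Type) (r : seq I) (x : I -> H) :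
  (forall i, op_dom T (x i)) ->
  op_dom T (\sum_(i <- r) x i) /\ T (\sum_(i <- r) x i) = \sum_(i <- r) T (x i).
Proof.
move=> Tx; elim: r => [|i r [dom_r T_r]].
  by rewrite !big_nil; split; [exact: op_dom0 | exact: op_fun0].
rewrite !big_cons -[x i]scale1r; split; first exact: op_domP.
by rewrite op_linear // T_r !scale1r.
Qed.

(** [T] commutes with finite sums in its domain, so Cauchy blocks go to Cauchy blocks; completeness
    gives a limit, left unidentified here. *)
Lemma bounded_operator_series (T : operator H) (x : nat -> H) :
  bounded_operator T -> (forall n, op_dom T (x n)) ->
  cvgn (series x) -> cvgn (series (T \o x)).
Proof.
move=> [M T_le] Tx /cauchy_cvgP/cauchy_seriesP x_cauchy.
apply/cauchy_cvgP/cauchy_seriesP => e e0.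
(* The bound [M] may be zero or negative, and a positive divisor is needed. *)
pose M' := `|M| + 1.
have M'0 : 0 < M'%:C by rewrite ltcR ltr_wpDl.
have := x_cauchy _ (divr_gt0 e0 M'0); apply: filterS => -[m n] /=.
have [dom_sum <-] := op_sum T _ (index_iota m n) x Tx.
rewrite ltr_pdivlMr // mulrC; apply: le_lt_trans.
apply: le_trans (T_le _ dom_sum) _; apply: ler_wpM2r => //.
by rewrite lecR /M' (le_trans (ler_norm M)) // lerDl.
Qed.

Lemma adjointP (T : operator H) y : adjoint_dom ip T y ->
  is_adjoint_value ip T y (adjoint ip T y).
Proof. by move=> [z Tz]; exact: (xgetPex 0 (ex_intro _ z Tz)). Qed.

End RealInnerProduct.

Theorem theorem5 (R : realType) (H : completeNormedModType R[i])
  (ip : {dot H for Num.conj}) (ip_norm : induces_norm ip)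
  (g h : nat -> H) (F : set H)
  (F_subspace : linear_subspace F) (F_neq0 : F <> [set 0])
  (gh_framing : framing_for ip g h F)
  (A B : operator H)
  (A_closed : closed_operator A) (A_dense : densely_defined A)
  (B_closed : closed_operator B) (B_dense : densely_defined B)
  (g_dom : forall n : nat, op_dom A (g n))
  (h_dom : forall n : nat, op_dom B (h n))
  (DB : set H) (DB_subspace : linear_subspace DB)
  (DB_sub : DB `<=` adjoint_dom ip B) (DB_dense : dense DB)
  (F_sub : F `<=` F_op ip A g h)
  (adj_id : forall f k : H, F f -> DB k ->
     ip (adjoint ip A f) (adjoint ip B k) = ip f k)
  (cond_i_or_ii :
     (forall f : H, F f ->
        weakly_subseries_convergent ip (fun n => ip f (A (g n)) *: B (h n)) \/
        strongly_subseries_convergent (fun n => ip f (A (g n)) *: B (h n)))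
     \/ bounded_operator B) :
  framing_for ip (fun n => A (g n)) (fun n => B (h n)) F.
Proof.
have sums f : F f -> F_max ip (fun n => A (g n)) (fun n => B (h n)) f.
  move=> Ff; have [dom_f u_max] := F_sub f Ff.
  set u := adjoint ip A f in u_max.
  have coef n : ip f (A (g n)) = ip u (g n).
    by rewrite ipC (adjointP _ _ _ _ _ dom_f _ (g_dom n)) -ipC.
  pose x n := ip u (g n) *: h n.
  have dom_x n : op_dom B (x n).
    by rewrite -[x n]addr0; apply: op_domP => //; exact: op_dom0.
  have aE : (fun n => ip f (A (g n)) *: B (h n)) = B \o x.
    by apply/funext => n /=; rewrite coef op_funZ.
  have x_cvg sigma : bijective sigma -> series (x \o sigma) @ \oo --> u.
    exact: u_max.
  have Bx_cvg sigma : bijective sigma -> cvgn (series ((B \o x) \o sigma)).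
    move=> bij_sigma; case: cond_i_or_ii => [/(_ f Ff)|B_bdd].
      by rewrite aE => /subseries_unconditional; exact.
    apply: (bounded_operator_series _ _ B (x \o sigma)) => //=.
    by apply/cvg_ex; exists u; exact: x_cvg.
  move=> sigma bij_sigma; rewrite aE.
  have /cvg_ex[s s_lim] := Bx_cvg _ bij_sigma.
  (* A priori [s] depends on [sigma]; testing against [DB] identifies it. *)
  suff <- : s = f by [].
  apply: (dense_rip_inj _ _ ip ip_norm _ _ _ DB_dense) => k DBk.
  (* The target [rip f k] becomes [rip u (B^* k)], so both sides are limits of one scalar
     sequence. *)
  rewrite {2}/rip -adj_id // -/u -/(rip _ _ ip u _).
  have s_rip := cvg_rip _ _ ip ip_norm _ _ k s_lim.
  have u_rip := cvg_rip _ _ ip ip_norm _ _ (adjoint ip B k) (x_cvg _ bij_sigma).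
  apply: (cvg_unique _ s_rip); first exact: Rhausdorff.
  suff -> : (fun n => rip _ _ ip (series ((B \o x) \o sigma) n) k) =
    (fun n => rip _ _ ip (series (x \o sigma) n) (adjoint ip B k)) by [].
  apply/funext => n; rewrite !rip_suml; apply: eq_bigr => i _ /=.
  by rewrite /rip (adjointP _ _ _ _ _ (DB_sub _ DBk)).
split; last exact: sums.
have F0 : F 0 by have [/set_mem] := F_subspace.
(* A framing needs a nonzero vector; it exists because [F] contains 0 but is not [[set 0]]. *)
have [f [Ff f0]] : exists f, F f /\ f <> 0.
  apply: contrapT => /forallNP noF; apply: F_neq0; apply/seteqP; split=> f.
    by move=> Ff; apply: contrapT => f0; apply: (noF f).
  by move=> ->.
by exists f; split=> //; exact: sums.
Qed.
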